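(* Let $G$ be a finite group and let $V$ be a finite faithful $G$-module. Let $v\in V$. Then $$k(GV,v)\leq |C_G(v)|\,|V|.$$ In particular, if $(|G|,|V|)=1$ and $G$ has a regular orbit on $V$ (i.e. there is $w\in V$ with $C_G(w)=1$), then $k(GV)\leq |V|$.
   Context: A finite $G$-module here is a finite vector space over a field of prime characteristic $p$ on which $G$ acts linearly. $GV$ denotes the semidirect product of $V$ by $G$ with respect to this action, $C_G(v)$ is the stabilizer of $v$ in $G$, and $k(X)$ is the number of conjugacy classes of a finite group $X$. For a finite group $X$ and $x\in X$, $\mathrm{Irr}(X,x)$ is the set of all irreducible complex characters $\chi\in\mathrm{Irr}(X)$ such that the restriction $\chi|_{\langle x\rangle}$ is not an integer multiple of the regular character of $\langle x\rangle$, and $k(X,x)=|\mathrm{Irr}(X,x)|$. *)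

(* Defs.v *)
From HB Require Import structures.
From mathcomp Require Import all_boot all_order all_fingroup all_algebra.
From mathcomp Require Import all_solvable all_field all_character.

Set Implicit Arguments.
Unset Strict Implicit.
Unset Printing Implicit Defensive.

Import GroupScope GRing.Theory.
Local Open Scope ring_scope.

(* Meaningful when x \in X, since 'Res[<[x]>] is the restriction only when
   <[x]> is a subgroup of X. *)
Definition Irr_at (gT : finGroupType) (X : {group gT}) (x : gT) :
    {set Iirr X} :=
  [set i | 'Res[<[x]>] 'chi[X]_i \notin 'Z[[:: cfReg <[x]>]]].

Definition k_at (gT : finGroupType) (X : {group gT}) (x : gT) : nat :=
  #|Irr_at X x|.

Definition k_classes (gT : finGroupType) (X : {group gT}) : nat :=
  #|classes X|.

Lemma in_Irr_at (gT : finGroupType) (X : {group gT}) (x : gT) (i : Iirr X) :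
  reflect (~ exists z : int, 'Res[<[x]>] 'chi_i = cfReg <[x]> *~ z)
          (i \in Irr_at X x).
Proof.
rewrite inE; apply: (iffP negP) => nZ; last first.
  case/zchar_expansion=> // z zint; rewrite big_seq1 => Dchi; apply: nZ.
  by have /Num.Theory.intrP[m Dm] := zint (cfReg <[x]>); exists m;
     rewrite Dchi Dm scaler_int.
by case=> z Dchi; apply: nZ; rewrite Dchi rpredMz // mem_zchar // inE.
Qed.

(* A finite vector space is a finLmodType over a field; as a finGroupType it is
   the additive group, so its multiplicative unit is the zero vector.  The
   action of G on V is written on the right; faithfulness is separate. *)
Definition linear_action (gT : finGroupType) (G : {group gT})
    (F : fieldType) (V : finLmodType F) (to : groupAction G [set: V]) : Prop :=
  forall g : gT, g \in G -> linear (fun u : V => (to u g : V)).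

(* The elements of sdprod_by to are pairs of G x V and sdpair1 to embeds V. *)
Definition semidirect (gT : finGroupType) (G : {group gT})
    (F : fieldType) (V : finLmodType F) (to : groupAction G [set: V]) :
    {group sdprod_by to} := [set: sdprod_by to]%G.

(* Main.v *)
Require Import Defs.
From HB Require Import structures.
From mathcomp Require Import all_boot all_order all_fingroup all_algebra.
From mathcomp Require Import all_solvable all_field all_character.

Set Implicit Arguments.
Unset Strict Implicit.
Unset Printing Implicit Defensive.

Import GroupScope Order.TTheory GRing.Theory Num.Theory.

(** If v has prime order p, a character chi restricts to a multiple of the
    regular character of <v> exactly when chi vanishes on <v> - 1, and, the
    values of chi there being Galois conjugate, exactly when chi(v) = 0.  For the
    other irreducible chi the product of the |chi(s)|^2 over the generators s of
    <v> is a positive integer, so by AM-GM these numbers average to at least 1;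
    column orthogonality then gives k(X, v) <= |C_X(v)|.  When X = GV with V of
    order prime to |G|, every irreducible degree divides |X : V| = |G| by Ito's
    theorem, so p does not divide it and no irreducible character restricts to a
    multiple of the regular character. *)

Section PrimeOrder.

Local Open Scope ring_scope.
Local Open Scope group_scope.

(** Here [y = x ^+ k] with [k] prime to [#[x]]. On [<[x]>] the character is a sum of linear ones, so
    the automorphism raising [#[x]]-th roots of unity to the power [k] sends [chi x] to [chi y]. *)
Lemma char_eq0_generator (gT : finGroupType) (X : {group gT}) (chi : 'CF(X))
    (x y : gT) :
  chi \is a character -> x \in X -> generator <[x]> y ->
  chi x = 0%R -> chi y = 0%R.
Proof.
move=> Nchi Xx gen_y chix0.
have sxX : <[x]> \subset X by rewrite cycle_subG.
have [k _ Dy] := cyclePmin (cycle_generator gen_y).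
rewrite Dy generator_coprime coprime_sym in gen_y; rewrite {}Dy.
have [u Du] := Qn_aut_exists gen_y.
have resE z : z \in <[x]> -> chi z = 'Res[<[x]>] chi z by move=> ?; rewrite cfResE.
suff: u (chi x) = chi (x ^+ k) by rewrite chix0 rmorph0.
rewrite !resE ?mem_cycle ?cycle_id //.
have /char_sum_irr[r ->] : 'Res[<[x]>] chi \is a character by rewrite cfRes_char.
rewrite !sum_cfunE rmorph_sum; apply: eq_bigr => i _.
have Lchi_i : 'chi_i \is a linear_char by rewrite irr_cyclic_lin ?cycle_cyclic.
rewrite lin_charX ?cycle_id // Du // -lin_charX ?cycle_id //.
by rewrite expg_order lin_char1.
Qed.

(** The restriction is ['chi_i 1 / #[x]] times the regular character; this factor is the
    multiplicity of the trivial character, hence an integer. *)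
Lemma notin_Irr_at (gT : finGroupType) (X : {group gT}) (x : gT) (i : Iirr X) :
  x \in X -> {in <[x]>, forall z, z != 1 -> 'chi_i z = 0%R} ->
  i \notin Irr_at X x.
Proof.
move=> Xx chi0; have sxX : <[x]> \subset X by rewrite cycle_subG.
have [n Dn] : exists n, '['Res[<[x]>] 'chi_i, 1] = n%:R%R.
  by apply/natrP; rewrite Cnat_cfdot_char ?cfun1_char ?cfRes_char ?irr_char.
rewrite inE negbK.
suff -> : 'Res[<[x]>] 'chi_i = (n%:R *: cfReg <[x]>)%R.
  by rewrite scaler_nat rpredMn // mem_zchar // inE.
apply/cfun_inP => z xz; rewrite cfResE // cfunE cfRegE.
have [->|nt_z] := eqVneq z 1; last by rewrite mulr0 chi0.
rewrite -Dn cfdotE (bigD1 1) //= big1 => [|t /andP[xt nt_t]]; last first.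
  by rewrite cfResE // chi0 // mul0r.
by rewrite addr0 cfRes1 cfun11 conjC1 mulr1 mulr1n mulrAC mulVf ?mul1r ?neq0CG.
Qed.

(** Settles the zero vector, whose order is not prime. *)
Lemma k_at1 (gT : finGroupType) (X : {group gT}) : k_at X 1 = 0%N.
Proof.
rewrite /k_at eq_card0 // => i; apply/negbTE/notin_Irr_at=> // z.
by rewrite cycle1 => /set1P->; rewrite eqxx.
Qed.

Lemma Irr_at_neq0 (gT : finGroupType) (X : {group gT}) (x : gT) (i : Iirr X) :
  x \in X -> prime #[x] -> i \in Irr_at X x ->
  {in generator <[x]>, forall y, 'chi_i y != 0%R}.
Proof.
move=> Xx p_pr + y gen_y; apply: contraL => /eqP chiy0.
have defy : <[x]> = <[y]> by apply/eqP.
have yX : y \in X.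
  by rewrite -cycle_subG -defy cycle_subG.
apply: notin_Irr_at => // z xz nt_z.
apply: char_eq0_generator chiy0; rewrite ?irr_char // -defy.
apply/eqP/nt_gen_prime; first by rewrite -orderE.
by rewrite !inE nt_z.
Qed.

Lemma k_at_le_cent1 (gT : finGroupType) (X : {group gT}) (x : gT) :
  x \in X -> prime #[x] -> (k_at X x <= #|'C_X[x]|)%N.
Proof.
move=> Xx p_pr; set S := [pred s | generator <[x]> s].
have sxX : <[x]> \subset X by rewrite cycle_subG.
(* Both sides are scaled by the number of generators, to be compared with one double sum over
   characters and generators. *)
have S_gt0 : (0 < #|S|)%N by apply/card_gt0P; exists x; rewrite inE /generator.
rewrite -(leq_pmul2r S_gt0) -(ler_nat algC) !natrM.
apply: (@le_trans _ _
   (\sum_(i in Irr_at X x) \sum_(s in S) `|'chi_i s| ^+ 2)%R).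
  rewrite mulr_natl -sumr_const; apply: ler_sum => i Ai.
  have := @sum_norm2_char_generators _ <[x]>%G ('Res 'chi_i).
  rewrite cfRes_char ?irr_char // => /(_ isT) le_S.
  have resE s : s \in S -> 'Res[<[x]>] 'chi_i s = 'chi_i s.
    by move=> Ss; rewrite cfResE // cycle_generator.
  rewrite (eq_bigr (fun s => `|'Res[<[x]>] 'chi_i s| ^+ 2)%R) => [|s Ss].
    by apply: le_S => s Ss; rewrite resE // (Irr_at_neq0 _ _ Ai).
  by rewrite resE.
(* For fixed [s] the sum is part of the full column sum [#|'C_X[s]|], and [s] has the same
   centralizer as [x]. *)
rewrite exchange_big /= mulr_natr -sumr_const; apply: ler_sum => s Ss.
have Xs : s \in X by rewrite (subsetP sxX) // cycle_generator.
have := second_orthogonality_relation s Xs; rewrite class_refl mulr1n.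
have -> : 'C_X[s] = 'C_X[x] by rewrite -!cent_cycle (eqP Ss).
move=> <-; rewrite [leRHS](bigID (mem (Irr_at X x))) /=.
rewrite (eq_bigr (fun i => 'chi_i s * ('chi_i s)^*)%R) => [|i _]; last first.
  by rewrite normCK.
by rewrite lerDl sumr_ge0 // => i _; rewrite mul_conjC_ge0.
Qed.

(* Ito's theorem: i is induced from some s on the inertia group T of a
   constituent of its restriction to A, and A lies in the centre of s, so that
   s(1) divides |T : A|. *)
Lemma dvd_irr1_index_abelian (gT : finGroupType) (G A : {group gT}) (i : Iirr G) :
  A <| G -> abelian A -> ('chi_i 1 %| #|G : A|)%C.
Proof.
move=> nsAG abA; have sAG := normal_sub nsAG.
have [t Ait] := constt_cfRes_irr A i.
have [_ _ imInd _ _] := constt_Inertia_bijection t nsAG.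
have : i \in irr_constt ('Ind[G] 'chi_t) by rewrite constt_Ind_Res.
rewrite -imInd => /imsetP[s As Di].
have [irrInd _ _ _ _] := constt_Inertia_bijection t nsAG.
have sTG : 'I_G['chi_t] \subset G := subsetIl _ _.
have nsAT := normal_Inertia 'chi_t sAG; have sAT := normal_sub nsAT.
have -> : 'chi_i = 'Ind[G] 'chi_s by rewrite Di cfIirrE ?irrInd.
have Lt : 'chi_t \is a linear_char by apply/char_abelianP.
rewrite cfInd1 //.
(* As ['chi_t] is linear and [T]-invariant, Clifford makes ['chi_s] a multiple of it on [A], so
   ['chi_s] has constant modulus there. *)
have sAZ : A \subset 'Z('chi_s)%CF.
  apply/subsetP=> a Aa; rewrite irr_cfcenterE ?(subsetP sAT) //.
  have DsA : 'Res[A] 'chi_s = ('['Res[A] 'chi_s, 'chi_t] *: 'chi_t)%R.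
    rewrite {1}(@Clifford_Res_sum_cfclass _ _ _ s t nsAT) ?cfclass_invariant ?subsetIr //.
      by rewrite big_seq1.
    by rewrite -constt_Ind_Res.
  rewrite -(cfResE 'chi_s sAT Aa) -(cfRes1 A 'chi_s) DsA !cfunE lin_char1 // mulr1.
  rewrite normrM normC_lin_char // mulr1 ger0_norm //.
  by rewrite natr_ge0 // Cnat_cfdot_char ?cfRes_char ?irr_char.
rewrite -(Lagrange_index sTG sAT). rewrite [X in (_ %| X)%C]natrM dvdC_mul2l ?neq0CiG //.
apply: dvdC_trans (dvd_irr1_index_center s) _.
by rewrite dvdC_nat indexgS.
Qed.

Lemma Irr_at_ndvd (gT : finGroupType) (X : {group gT}) (x : gT) (i : Iirr X) :
  x \in X -> ~~ (#[x]%g %| 'chi_i 1%g)%C -> i \in Irr_at X x.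
Proof.
move=> Xx ndvd; apply/in_Irr_at=> -[z Dz]; case/negP: ndvd.
have := congr1 (fun phi : 'CF(<[x]>) => phi 1) Dz.
rewrite /= cfRes1 => ->; rewrite -scaler_int cfunE cfRegE eqxx mulr1n -orderE.
by rewrite dvdC_mull ?intr_int.
Qed.

End PrimeOrder.

Section Semidirect.

Variables (gT : finGroupType) (G : {group gT}) (F : fieldType).
Variables (V : finLmodType F) (to : groupAction G [set: V]).

Lemma mulgC_finLmod (u v : V) : u * v = v * u.
Proof. by rewrite !FinRing.zmodMgE addrC. Qed.

Lemma card_semidirect : #|semidirect to| = (#|V| * #|G|)%N.
Proof.
rewrite /semidirect /= -(sdprod_card (sdprod_sdpair to)).
by rewrite !card_injm ?injm_sdpair1 ?injm_sdpair2 // cardsT.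
Qed.

(** Since [V] is abelian, the [G]-component of an element centralizing [v] also centralizes [v]; the
    centralizer thus lies in the product of ['C_G[v | to]] and [V]. *)
Lemma card_cent1_sdpair1 (v : V) :
  (#|'C_(semidirect to)[sdpair1 to v]| <= #|'C_G[v | to]| * #|V|)%N.
Proof.
rewrite -[#|V|]cardsT -(card_injm (injm_sdpair1 to)) //.
rewrite -(card_injm (injm_sdpair2 to)) ?subsetIl //.
rewrite mul_cardG; apply: leq_trans (leq_pmulr _ (cardG_gt0 _)).
apply/subset_leq_card/subsetP=> u /setIP[_ /cent1P cuv].
have Gu1 : u.1 \in G by case: u {cuv} => -[a w] /= /setXP[].
rewrite [u]sdpairE mem_mulg ?mem_morphim ?inE //.
have cV : commute (sdpair1 to u.2) (sdpair1 to v).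
  by rewrite /commute -!morphM ?inE // mulgC_finLmod.
have cu1 : commute (sdpair2 to u.1) (sdpair1 to v).
  have -> : sdpair2 to u.1 = u * (sdpair1 to u.2)^-1.
    by rewrite [X in X * _]sdpairE mulgK.
  by apply: commute_sym; apply: commuteM; [|apply: commuteV]; apply: commute_sym.
rewrite Gu1 sub1set inE; apply/eqP.
apply: (injmP (injm_sdpair1 to)); rewrite ?inE //=.
by rewrite sdpair_act ?inE // /conjg -cu1 mulKg.
Qed.

Lemma order_sdpair1 (p : nat) (v : V) :
  p \in [pchar F]%R -> v != 1 -> #[sdpair1 to v] = p.
Proof.
move=> charFp nt_v; rewrite order_injm ?injm_sdpair1 ?inE //.
apply: nt_prime_order => //; first exact: pcharf_prime charFp.
by rewrite FinRing.zmodXgE -scaler_nat (pcharf0 charFp) scale0r.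
Qed.

End Semidirect.

Theorem proposition3p1 (gT : finGroupType) (G : {group gT})
    (p : nat) (F : fieldType) (charF : p \in [pchar F]%R)
    (V : finLmodType F) (to : groupAction G [set: V])
    (linG : linear_action to) (faithG : [faithful G, on [set: V] | to]) :
  (forall v : V,
     k_at (semidirect to) (sdpair1 to v) <= #|'C_G[v | to]| * #|V|)%N
  /\
  (coprime #|G| #|V| ->
   (exists w : V, 'C_G[w | to] = 1) ->
   (k_classes (semidirect to) <= #|V|)%N).
Proof.
have p_pr := pcharf_prime charF.
have k_at_le (v : V) : v != 1 ->
    (k_at (semidirect to) (sdpair1 to v) <= #|'C_G[v | to]| * #|V|)%N.
  move=> nt_v; apply: leq_trans (card_cent1_sdpair1 to v).
  by rewrite k_at_le_cent1 ?inE // (order_sdpair1 to charF).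
split=> [v | coGV [w regw]].
  have [-> | /k_at_le //] := eqVneq v 1.
  by rewrite morph1 k_at1.
(* If [w] is the zero vector, [G] fixes it and so is trivial; the order of the semidirect product
   then bounds its class number. *)
have [w1 | nt_w] := eqVneq w 1.
  have G1 : G :=: 1.
    rewrite -regw w1; apply/esym/setIidPl/subsetP=> g Gg.
    by rewrite !inE Gg sub1set inE; apply/eqP; apply: gact1.
  rewrite /k_classes (leq_trans (leq_imset_card _ _)) //.
  by rewrite card_semidirect G1 cards1 muln1.
apply: leq_trans (_ : k_at (semidirect to) (sdpair1 to w) <= _)%N; last first.
  by apply: leq_trans (k_at_le w nt_w) _; rewrite regw cards1 mul1n.
rewrite /k_classes -NirrE -[Nirr _]card_ord /k_at subset_leq_card //.
apply/subsetP=> i _; apply: Irr_at_ndvd; first by rewrite inE.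
rewrite (order_sdpair1 to charF nt_w); apply/negP => p_dvd.
have nsV : sdpair1 to @* [set: V] <| semidirect to.
  by case/sdprod_context: (sdprod_sdpair to).
have abV : abelian (sdpair1 to @* [set: V]).
  by rewrite morphim_abelian //; apply/centsP=> u _ u' _; apply: mulgC_finLmod.
have := dvdC_trans p_dvd (dvd_irr1_index_abelian i nsV abV).
rewrite dvdC_nat -divgS ?normal_sub // card_semidirect.
rewrite (card_injm (injm_sdpair1 to)) // cardsT mulKn; last first.
  by apply/card_gt0P; exists w.
apply/negP; rewrite -prime_coprime // coprime_sym.
apply: coprime_dvdr coGV.
(* Being the order of [w], [p] divides [#|V|]. *)
have <- : #[w] = p.
  by rewrite -(order_sdpair1 to charF nt_w) order_injm ?injm_sdpair1 ?inE.
by rewrite -[#|V|]cardsT order_dvdG ?inE.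
Qed.
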